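(* Every algorithm that determines the majority bit of a binary string of length $n$ (or reports that none exists) using bit comparisons requires, on average over the uniform distribution on $\{0,1\}^n$, at least $2n/3 - O(\sqrt{n\log n})$ comparisons.
   Context: The majority bit of $x=x_1\cdots x_n\in\{0,1\}^n$ is the bit appearing more than $\lfloor n/2\rfloor$ times; if none exists, the algorithm must report ''no majority''. The algorithm accesses the input only through comparisons, each of which reveals whether two chosen bits $x_i,x_j$ are equal. Complexity is the number of comparisons made. *)

(* Defs.v *)
From mathcomp Require Import all_boot all_order all_algebra.
From mathcomp Require Import all_classical all_reals all_analysis.

Set Implicit Arguments.
Unset Strict Implicit.
Unset Printing Implicit Defensive.

Import Order.TTheory GRing.Theory Num.Theory.

(* A deterministic adaptive algorithm on inputs of length [n], as a decision
   tree.  Equality tests are invariant under complementing the input, so no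
   algorithm can output the value of the majority bit: an answer [Some i] names
   it by a position [i] holding it, and [None] reports "no majority". *)
Inductive algo (n : nat) : Type :=
| Answer of option 'I_n
| Compare (i j : 'I_n) (if_eq if_neq : algo n).

Fixpoint output n (A : algo n) (x : n.-tuple bool) : option 'I_n :=
  match A with
  | Answer o => o
  | Compare i j E N =>
      if tnth x i == tnth x j then output E x else output N x
  end.

Fixpoint comparisons n (A : algo n) (x : n.-tuple bool) : nat :=
  match A with
  | Answer _ => 0
  | Compare i j E N =>
      (if tnth x i == tnth x j then comparisons E x else comparisons N x).+1
  end.

Definition majority_bit n (x : n.-tuple bool) (b : bool) : bool :=
  n./2 < count_mem b x.

Definition determines_majority n (A : algo n) : Prop :=
  forall x : n.-tuple bool,
    match output A x return Prop with
    | Some i => majority_bit x (tnth x i)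
    | None => ~ exists b : bool, majority_bit x b
    end.

Local Open Scope ring_scope.

Definition average_comparisons (R : realType) n (A : algo n) : R :=
  (\sum_(x : n.-tuple bool) (comparisons A x)%:R) / 2 ^+ n.

(* Main.v *)
(** Comparisons glue positions into classes inside which the input is known up
    to complementation; let [d] be the signed excess of [false] over [true] in a
    class. Merging classes of imbalances [d] and [d'] gives [d + d'] or [d - d'],
    each with probability 1/2: on average [sum d^2] is preserved and the number
    [N] of nonzero imbalances drops by at most 3/2. When the algorithm stops, one
    class dominates all the others together (or all imbalances vanish), so
    [N^2 <= sum d^2]. The potential [2/3 N - sum d^2 / (3t)] thus drops by at most
    1 per comparison, from [2n/3 - n/(3t)] to at most [t/3] by AM-GM, and
    [t = sqrt n] gives the bound [2n/3 - 2/3 sqrt n]. *)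

Require Import Defs.
From mathcomp Require Import all_boot all_order all_algebra.
From mathcomp Require Import all_classical all_reals all_analysis.
From mathcomp Require Import zify ring lra.
Import Order.TTheory GRing.Theory Num.Theory.
Import numFieldNormedType.Exports.
Local Open Scope classical_set_scope.
Local Open Scope ring_scope.

(** Correctness at one input: a subtree need only be correct on the inputs that reach it. *)
Definition determines_at n (A : algo n) (x : n.-tuple bool) : Prop :=
  match output A x return Prop with
  | Some i => majority_bit x (tnth x i)
  | None => ~ exists b : bool, majority_bit x b
  end.

(* The inputs compatible with the outcomes seen so far: position [i] lies in the
   class labelled [c i] and differs from the free bit of that class iff [s i].
   Bits of [y] at unused labels are irrelevant. *)
Definition decode n (c : 'I_n -> 'I_n) (s : 'I_n -> bool) (y : n.-tuple bool) :
  n.-tuple bool := [tuple s i (+) tnth y (c i) | i < n].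

Definition imbalance n (c : 'I_n -> 'I_n) (s : 'I_n -> bool) (l : 'I_n) : int :=
  \sum_(i | c i == l) (-1) ^+ s i.

Definition merge_class n (c : 'I_n -> 'I_n) (a b i : 'I_n) : 'I_n :=
  if c i == b then a else c i.

(** [e] is the difference between the free bits of [a] and [b]. *)
Definition merge_sign n (c : 'I_n -> 'I_n) (s : 'I_n -> bool) (b : 'I_n)
    (e : bool) (i : 'I_n) : bool :=
  if c i == b then s i (+) e else s i.

Definition weight (R : realType) (t : R) (d : int) : R :=
  2 / 3 * (d != 0)%:R - (d ^+ 2)%:~R / (3 * t).

Lemma weight0 (R : realType) (t : R) : weight R t 0 = 0.
Proof. by rewrite /weight eqxx expr0n /= mulr0 mul0r subrr. Qed.

(** The squares cancel by the parallelogram law. If [d] and [d'] are both nonzero, at most one of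
    [d + d'], [d - d'] vanishes, whence the 3 in the count of nonzero terms. *)
Lemma weight_merge (R : realType) (t : R) (d d' : int) :
  2 * (weight R t d + weight R t d') <=
    2 + (weight R t (d + d') + weight R t (d - d')).
Proof.
rewrite /weight.
have -> : ((d + d') ^+ 2)%:~R = (d ^+ 2 + d' ^+ 2 + 2 * d * d')%:~R :> R.
  by congr (_%:~R); ring.
have -> : ((d - d') ^+ 2)%:~R = (d ^+ 2 + d' ^+ 2 - 2 * d * d')%:~R :> R.
  by congr (_%:~R); ring.
rewrite rmorphB !rmorphD /= !(mulrDl, mulNr).
have : (2 * ((d != 0)%:R + (d' != 0)%:R) <=
   3 + ((d + d' != 0)%:R + (d - d' != 0)%:R) :> R).
  rewrite -!(natrM, natrD) ler_nat; lia.
by move: (3 * t)^-1 => v; lra.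
Qed.

(* The label [b] survives the merge with an empty class, hence imbalance 0; as
   [weight t 0 = 0], no record of the live labels is needed. *)
Lemma imbalance_merge n (c : 'I_n -> 'I_n) s a b e l : a != b ->
  imbalance n (merge_class n c a b) (merge_sign n c s b e) l =
  if l == b then 0 else if l == a then
    imbalance n c s a + (-1) ^+ e * imbalance n c s b else imbalance n c s l.
Proof.
move=> ab; rewrite /imbalance /merge_class /merge_sign.
have [->|lb] := eqVneq l b.
  by apply: big_pred0 => i; case: (eqVneq (c i) b) => [_|/negbTE //]; exact: negbTE.
have [->|la] := eqVneq l a.
  rewrite (bigID (fun i => c i == b)) /= addrC; congr (_ + _).
    apply: eq_big => [i|i /andP[_ /negbTE ->]//].
    by case: (eqVneq (c i) b) => [->|]; rewrite ?andbT // andbF eq_sym (negbTE ab).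
  rewrite mulr_sumr; apply: eq_big => [i|i].
    by case: (eqVneq (c i) b); rewrite ?eqxx ?andbF.
  by case/andP=> _ ->; rewrite signr_addb mulrC.
apply: eq_big => i; case: (eqVneq (c i) b) => // ci.
  by rewrite ci ![_ == l]eq_sym (negbTE la) (negbTE lb).
by rewrite eq_sym (negbTE la).
Qed.

Lemma decode_merge n c s a b e (y : n.-tuple bool) :
  tnth y b = tnth y a (+) e ->
  decode n (merge_class n c a b) (merge_sign n c s b e) y = decode n c s y.
Proof.
move=> yb; apply: eq_from_tnth => i; rewrite !tnth_mktuple /merge_class /merge_sign.
by case: eqP => // ->; rewrite yb -!addbA (addbC e).
Qed.

Definition set_bit n (b : 'I_n) (v : bool) (y : n.-tuple bool) : n.-tuple bool :=
  [tuple if l == b then v else tnth y l | l < n].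

(** No position carries the label [b] after the merge. *)
Lemma decode_merge_set n c s a b e v (y : n.-tuple bool) : a != b ->
  decode n (merge_class n c a b) (merge_sign n c s b e) (set_bit n b v y) =
  decode n (merge_class n c a b) (merge_sign n c s b e) y.
Proof.
move=> ab; apply: eq_from_tnth => i; rewrite !tnth_mktuple /merge_class.
by case: (eqVneq (c i) b) => [_|/negbTE ->]; rewrite ?(negbTE ab).
Qed.

(* The left-hand side ignores the bit [b] of [y], so flipping that bit pairs the
   terms satisfying the condition with the others. *)
Lemma sum_decode_merge (R : realType) n c s a b e (F : n.-tuple bool -> R) :
  a != b ->
  \sum_y F (decode n (merge_class n c a b) (merge_sign n c s b e) y) =
  2 * \sum_(y | tnth y b == tnth y a (+) e) F (decode n c s y).
Proof.
move=> ab; pose flip (y : n.-tuple bool) := set_bit n b (~~ tnth y b) y.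
have flipK : involutive flip.
  move=> y; apply: eq_from_tnth => l; rewrite !tnth_mktuple eqxx negbK.
  by case: eqP => // ->.
rewrite (bigID (fun y : n.-tuple bool => tnth y b == tnth y a (+) e)) /=.
rewrite [X in _ + X](reindex_inj (inv_inj flipK)) /=.
have -> : \sum_(y | tnth (flip y) b != tnth (flip y) a (+) e)
    F (decode n (merge_class n c a b) (merge_sign n c s b e) (flip y)) =
  \sum_(y | tnth y b == tnth y a (+) e)
    F (decode n (merge_class n c a b) (merge_sign n c s b e) y).
  apply: eq_big => y; last by rewrite decode_merge_set.
  rewrite !tnth_mktuple eqxx (negbTE ab).
  by case: (tnth y a) (tnth y b) e => [] [] [].
rewrite -mulr2n mulr_natl; congr (_ *+ 2).
by apply: eq_bigr => y /eqP yb; rewrite decode_merge.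
Qed.

Lemma sum_weight_merge (R : realType) (t : R) n c s (a b : 'I_n) e : a != b ->
  \sum_l weight R t (imbalance n (merge_class n c a b) (merge_sign n c s b e) l) =
  weight R t (imbalance n c s a + (-1) ^+ e * imbalance n c s b) +
  \sum_(l | (l != a) && (l != b)) weight R t (imbalance n c s l).
Proof.
move=> ab; rewrite (bigD1 a) //= (bigD1 b) 1?eq_sym //=.
rewrite !imbalance_merge // eqxx eqxx (negbTE ab) weight0 add0r; congr (_ + _).
by apply: eq_bigr => l /andP[/negbTE la /negbTE lb]; rewrite imbalance_merge // lb la.
Qed.

Lemma sum_sign n (x : n.-tuple bool) (b : bool) :
  (-1) ^+ b * \sum_i (-1) ^+ tnth x i = (2 * count_mem b x)%:Z - n%:Z.
Proof.
have -> : count_mem b x = (\sum_i (tnth x i == b))%N.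
  by rewrite -sum1_count big_tuple big_mkcond /=; apply: eq_bigr => i _; case: eqP.
have -> : n%:Z = \sum_(i < n) 1 by rewrite sumr_const card_ord natz.
rewrite PoszM -[Posz (\sum_i _)%N]natz natr_sum !mulr_sumr -sumrB; apply: eq_bigr => i _.
by case: (tnth x i) b => [] [].
Qed.

Lemma majority_bitE n (x : n.-tuple bool) (b : bool) :
  majority_bit x b = (0 < (-1) ^+ b * \sum_i (-1) ^+ tnth x i :> int).
Proof. by rewrite sum_sign /majority_bit; apply/idP/idP; lia. Qed.

Lemma sum_sign_decode n c s (y : n.-tuple bool) :
  \sum_i (-1) ^+ tnth (decode n c s y) i =
  \sum_l (-1) ^+ tnth y l * imbalance n c s l :> int.
Proof.
rewrite (partition_big c predT) //=; apply: eq_bigr => l _.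
rewrite mulr_sumr; apply: eq_bigr => i /eqP <-.
by rewrite tnth_mktuple signr_addb mulrC.
Qed.

Lemma answer_imbalance n c s (o : option 'I_n) :
  (forall y, determines_at n (Answer o) (decode n c s y)) ->
  exists2 m : int, \sum_l (imbalance n c s l != 0)%:R <= m &
    m ^+ 2 <= \sum_l imbalance n c s l ^+ 2.
Proof.
set D := imbalance n c s; rewrite /determines_at /=; case: o => [i|] H.
  exists `|D (c i)|; last first.
    rewrite real_normK ?num_real // (bigD1 (c i)) //= lerDl.
    by apply: sumr_ge0 => l _; rewrite sqr_ge0.
  (* The adversary sets every class other than [c i] against [i]. *)
  pose y := [tuple if l == c i then s i else 0 < D l | l < n].
  have := H y; rewrite majority_bitE sum_sign_decode -/D.
  rewrite {1}/decode !tnth_mktuple eqxx addbb mul1r.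
  rewrite (bigD1 (c i)) //= tnth_mktuple eqxx.
  rewrite [X in _ + X](_ : _ = - \sum_(l | l != c i) `|D l|); last first.
    rewrite -sumrN; apply: eq_bigr => l /negbTE lc; rewrite tnth_mktuple lc.
    by case: ltP => h; rewrite ?expr1 ?expr0; lia.
  (* The strictness of [lt] between integers pays for the class [c i] itself in the count. *)
  move=> lt; rewrite (bigD1 (c i)) //=.
  have le : \sum_(l | l != c i) (D l != 0)%:R <= \sum_(l | l != c i) `|D l|.
    by apply: ler_sum => l _; case: eqP; lia.
  move: (\sum_(l | _) _) (\sum_(l | _) _) lt le => u v.
  by case: (s i) => /=; rewrite ?expr1 ?expr0; case: (D (c i) != 0) => /=; lia.
have sum0 : \sum_l `|D l| = 0.
  (* Aligning all classes makes [false] lead by the sum of the [|D l|]. *)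
  pose y := [tuple D l < 0 | l < n].
  have := H y; set x := decode n c s y => Hx.
  have -> : \sum_l `|D l| = \sum_i (-1) ^+ tnth x i.
    rewrite sum_sign_decode; apply: eq_bigr => l _; rewrite tnth_mktuple -/D.
    by case: ltP => h; rewrite ?expr1 ?expr0; lia.
  case: (ltgtP (\sum_i (-1) ^+ tnth x i : int) 0) => // h; case: Hx.
    by exists true; rewrite majority_bitE expr1; lia.
  by exists false; rewrite majority_bitE expr0; lia.
exists 0; last by rewrite expr0n sumr_ge0 // => l _; rewrite sqr_ge0.
rewrite -[leRHS]sum0; apply: ler_sum => l _; case: eqP; lia.
Qed.

Lemma sum_weight_answer (R : realType) (t : R) n c s (o : option 'I_n) : 0 < t ->
  (forall y, determines_at n (Answer o) (decode n c s y)) ->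
  \sum_l weight R t (imbalance n c s l) <= t / 3.
Proof.
move=> t0 /answer_imbalance[m]; set D := imbalance n c s => N_le m2.
rewrite /weight sumrB -mulr_sumr -mulr_suml.
have {}N_le : \sum_l (D l != 0)%:R <= m%:~R :> R.
  apply: le_trans (_ : (\sum_l (D l != 0)%:R : int)%:~R <= _); last by rewrite ler_int.
  by rewrite rmorph_sum /=; apply: ler_sum => l _; case: (D l != 0).
have {}m2 : m%:~R ^+ 2 <= \sum_l (D l ^+ 2)%:~R :> R.
  by rewrite -rmorphXn /= -rmorph_sum /= ler_int.
set N : R := \sum_l _ in N_le *; set S : R := \sum_l _ in m2 *.
rewrite lerBlDr -(ler_pM2r (_ : 0 < 3 * t)) ?mulr_gt0 //.
rewrite [leRHS]mulrDl divfK ?gt_eqF ?mulr_gt0 //.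
(* After clearing denominators, what remains is [2 m t - m^2 <= t^2]. *)
have := sqr_ge0 (t - m%:~R); have := ler_wpM2r (ltW t0) N_le.
move: (m%:~R : R) m2 => M; nra.
Qed.

(** Letting [y] range over all tuples, dead labels included, keeps the factor [2 ^+ n] the same at
    every node of the tree and does not change averages. *)
Lemma comparisons_ge (R : realType) (t : R) n (A : algo n) c s : 0 < t ->
  (forall y, determines_at n A (decode n c s y)) ->
  2 ^+ n * (\sum_l weight R t (imbalance n c s l) - t / 3) <=
    \sum_y (comparisons A (decode n c s y))%:R.
Proof.
move=> t0; elim: A c s => [ans|i j E IHE N IHN] c s H.
  rewrite /= [leRHS]big1 // mulr_ge0_le0 ?exprn_ge0 // subr_le0.
  exact: sum_weight_answer H.
have sumS (F : n.-tuple bool -> nat) :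
    \sum_y (F y).+1%:R = 2 ^+ n + \sum_y (F y)%:R :> R.
  under eq_bigr do rewrite -natr1 addrC.
  by rewrite big_split /= sumr_const card_tuple card_bool natrX.
rewrite /= sumS.
have p2 : 0 < 2 ^+ n :> R by rewrite exprn_gt0.
(* Inside one class the outcome is forced: the state is unchanged and the comparison is wasted. *)
have [cij|cij] := eqVneq (c i) (c j).
  have q (y : n.-tuple bool) :
      (tnth (decode n c s y) i == tnth (decode n c s y) j) = (s i == s j).
    by rewrite !tnth_mktuple cij (inj_eq (can_inj (addbK _))).
  under [X in _ <= _ + X]eq_bigr do rewrite q.
  have {}H y : determines_at n (if s i == s j then E else N) (decode n c s y).
    by have := H y; rewrite /determines_at /= q; case: ifP.
  by case: ifP H => _ H; [apply: le_trans (IHE _ _ H) _ | apply: le_trans (IHN _ _ H) _];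
     rewrite lerDr ltW.
set a := c i in cij; set b := c j in cij; pose e := s i (+) s j.
have q (y : n.-tuple bool) :
    (tnth (decode n c s y) i == tnth (decode n c s y) j) =
    (tnth y b == tnth y a (+) e).
  rewrite !tnth_mktuple -/a -/b /e.
  by case: (s i) (s j) (tnth y a) (tnth y b) => [] [] [] [].
have q' (y : n.-tuple bool) :
    (tnth y b != tnth y a (+) e) = (tnth y b == tnth y a (+) ~~ e).
  by case: (e) (tnth y a) (tnth y b) => [] [] [].
(* An input decoded after the merge is one decoded before it, with the outcome prescribed by [d]; so
   each subtree inherits correctness. *)
have merged d y : exists2 z, tnth z b = tnth z a (+) d &
    decode n (merge_class n c a b) (merge_sign n c s b d) y = decode n c s z.
  exists (set_bit n b (tnth y a (+) d) y).
    by rewrite !tnth_mktuple eqxx (negbTE cij).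
  rewrite -(decode_merge_set n c s a b d (tnth y a (+) d) y cij).
  by apply: decode_merge; rewrite !tnth_mktuple eqxx (negbTE cij).
have /IHE : forall y, determines_at n E
    (decode n (merge_class n c a b) (merge_sign n c s b e) y).
  move=> y; have [z zb ->] := merged e y.
  by have := H z; rewrite /determines_at /= q zb eqxx.
have /IHN : forall y, determines_at n N
    (decode n (merge_class n c a b) (merge_sign n c s b (~~ e)) y).
  move=> y; have [z zb ->] := merged (~~ e) y.
  by have := H z; rewrite /determines_at /= q ifN // q' zb.
rewrite !(sum_decode_merge R n c s a b _ (fun x => (comparisons _ x)%:R)) //.
rewrite !sum_weight_merge //.
rewrite [X in _ -> _ -> _ <= _ + X](bigID
  (fun y : n.-tuple bool => tnth y b == tnth y a (+) e)) /=.
under [X in _ -> _ -> _ <= _ + (X + _)]eq_bigr => y yb do rewrite q yb.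
under [X in _ -> _ -> _ <= _ + (_ + X)]eq_bigr => y yb do rewrite q (negbTE yb).
under [X in _ -> _ -> _ <= _ + (_ + X)]eq_bigl do rewrite q'.
rewrite [X in _ -> _ -> _ * (X - _) <= _](bigD1 a) //=.
rewrite [X in _ -> _ -> _ * (_ + X - _) <= _](bigD1 b) 1?eq_sym //=.
(* The two branches carry the imbalances [d + d'] and [d - d'], in an order depending on [e], and
   each accounts for half of the tuples [y]. *)
have := weight_merge R t (imbalance n c s a) (imbalance n c s b).
set S := \sum_(l | _) _; set U := \sum_(y | _) _; set V := \sum_(y | _) _.
move: (2 ^+ n) p2 => P p2.
by move: U V => U V; case: (e) => /=; rewrite ?expr1 ?expr0 ?mulN1r ?mul1r; nra.
Qed.

Theorem theorem5 (R : realType) :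
  exists2 f : nat -> R,
    f =O_\oo (fun n : nat => Num.sqrt (n%:R * ln n%:R) : R) &
    forall (n : nat) (A : algo n), determines_majority A ->
      2 * n%:R / 3 - f n <= average_comparisons R A.
Proof.
exists (fun n => 2 / 3 * Num.sqrt n%:R).
  apply/eqOP; near=> k; near=> n.
  (* From [n >= e] on, the logarithm is at least 1 and the square root of [n] is below the required
     rate. *)
  have n1 : expR 1 <= n%:R :> R by near: n; exact: nbhs_infty_ger.
  have n0 : 0 < n%:R :> R by apply: lt_le_trans n1; rewrite expR_gt0.
  have k1 : 1 <= k by near: k; exact: nbhs_pinfty_ge.
  have ln1 : 1 <= ln n%:R :> R by rewrite -[leLHS]expRK ler_ln ?posrE ?expR_gt0.
  have le : Num.sqrt n%:R <= Num.sqrt (n%:R * ln n%:R) :> R.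
    by rewrite ler_wsqrtr // ler_peMr // ltW.
  rewrite !ger0_norm ?mulr_ge0 ?sqrtr_ge0 ?divr_ge0 //.
  have := sqrtr_ge0 (n%:R : R); nra.
move=> n A H; rewrite /average_comparisons ler_pdivlMr ?exprn_gt0 //.
(* The choice of [t] as the square root of [n] is positive only for [n > 0]. *)
have [n0|n0] := posnP n.
  by subst n; rewrite sqrtr0 !mulr0 mul0r subrr mul0r sumr_ge0.
set t := Num.sqrt _; have t0 : 0 < t by rewrite sqrtr_gt0 ltr0n.
(* Initially each position is its own class, of imbalance 1. *)
have dec y : decode n id (fun=> false) y = y.
  by apply: eq_from_tnth => i; rewrite tnth_mktuple.
have /(comparisons_ge R t n A id (fun=> false) t0) :
    forall y, determines_at n A (decode n id (fun=> false) y).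
  by move=> y; rewrite dec; exact: H.
under [X in _ <= X -> _]eq_bigr do rewrite dec.
apply: le_trans; rewrite mulrC ler_wpM2l ?exprn_ge0 //.
under eq_bigr do rewrite /imbalance big_pred1_eq /weight /= expr1n.
rewrite sumr_const card_ord -[X in _ <= X - _]mulr_natr.
have -> : n%:R = t ^+ 2 by rewrite sqr_sqrtr.
by rewrite mulr1z le_eqVlt; apply/orP; left; apply/eqP; field; rewrite gt_eqF.
Unshelve. all: by end_near.
Qed.
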